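(* Let $d=p^e$ with $p$ prime and $e\geq 1$, let $c_0\in\mathbb{C}$, and suppose $f=f_{d,c_0}$ is postcritically finite of exact type $(m,n)$ with $m>0$. Let $\zeta:=a_{m+n-1}(c_0)/a_{m-1}(c_0)$ (which is a $d$-th root of unity different from $1$), let $0\leq r\leq e-1$ be the smallest nonnegative integer such that $\zeta^{p^{r+1}}=1$, and let $K:=\mathbb{Q}(c_0)$ with ring of integers $\mathcal{O}_K$. Then for every $i\geq 1$: (a) If $n\nmid m-1$, then $\langle a_i(c_0)\rangle^{p^r(p-1)d^{m-1}}=\langle p\rangle$ if $n\mid i$, and $=\mathcal{O}_K$ if $n\nmid i$. (b) If $n\mid m-1$, then $\langle a_i(c_0)\rangle^{p^r(p-1)(d^{m-1}-1)}=\langle p\rangle$ if $n\mid i$, and $=\mathcal{O}_K$ if $n\nmid i$.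
   Context: For an integer $d\geq 2$ and parameter $c$, $f_{d,c}(z)=z^d+c$, and $a_i(c):=f_{d,c}^i(0)\in\mathbb{Z}[c]$ (so $a_0=0$, $a_1=c$, $a_2=c^d+c$, ...). The map $f_{d,c_0}$ is postcritically finite (PCF) of exact type $(m,n)$ if $f^{m+n}(0)=f^m(0)$ with $m\geq 0$, $n\geq 1$ minimal, i.e. $0$ is preperiodic with tail length $m$ and the exact period of $f^m(0)$ is $n$. For $b\in\mathcal{O}_K$, $\langle b\rangle$ denotes the principal ideal of $\mathcal{O}_K$ generated by $b$. *)

(* Defs.v *)
From mathcomp Require Export all_boot all_order all_algebra.
From mathcomp Require Export complex.
From mathcomp Require Export boolp classical_sets reals.

Set Implicit Arguments.
Unset Strict Implicit.
Unset Printing Implicit Defensive.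

Import GRing.Theory.
Local Open Scope ring_scope.
Local Open Scope classical_set_scope.

Definition unicritical (A : nzRingType) (d : nat) (c z : A) : A := z ^+ d + c.

(* The value a_i(c); over A := {poly int} with c := 'X it is the polynomial
   a_i in Z[c] itself. *)
Definition crit_orbit (A : nzRingType) (d : nat) (c : A) (i : nat) : A :=
  iter i (unicritical d c) 0.

Definition pcf_exact_type (A : nzRingType) (d : nat) (c : A) (m n : nat) : Prop :=
  [/\ (0 < n)%N,
      crit_orbit d c (m + n) = crit_orbit d c m
    & forall m' n' : nat, (0 < n')%N ->
        crit_orbit d c (m' + n') = crit_orbit d c m' ->
        (m <= m')%N /\ (n <= n')%N].

Section NumberField.
Variable F : fieldType.

(* Q(x): the smallest subfield containing x, for F of characteristic 0. *)
Definition Qadjoin (x : F) : set F :=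
  [set y | forall S : {pred F}, GRing.divring_closed S -> x \in S -> y \in S].

Definition ring_of_integers (K : set F) : set F :=
  [set y | K y /\ integralOver (intr : int -> F) y].

Definition principal_ideal (O : set F) (b : F) : set F :=
  [set b * y | y in O].

Definition ideal_mul (I J : set F) : set F :=
  [set x | exists (k : nat) (u v : 'I_k -> F),
     [/\ forall j, I (u j), forall j, J (v j) & x = \sum_(j < k) u j * v j]].

Definition ideal_exp (O I : set F) (k : nat) : set F := iter k (ideal_mul I) O.

End NumberField.

(* Main.v *)
(** All of the argument takes place in the ring A of algebraic integers of C, using
    only divisibility and Bezout relations between elements; since every ideal in
    the statement is principal, it suffices to show that [a_i ^ N] is an
    A-associate of [p] (resp. of [1]).

    Write [D_j = a_{n+j} - a_j]. As [d = p^e], [D_{j+1} = D_j (D_j^{d-1} + p s)]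
    with [s] in A, and [D_{m-1} = (zeta - 1) a_{m-1}].  Modulo any ideal, the
    indices [k] with [a_k = 0] are closed under gcd and, if any is positive, include [n], so [a_i] is
    associate to [a_gcd(i,n)].  For a proper divisor [g] of [n], the periodicity of
    [a_{g+j} - a_j] shows that [a_g] is prime to [p], while [a_g^d] divides
    [(zeta - 1) a_{m-1}]; together these force [a_g] to be a unit.

    Since [a_n^d] divides [D_{m-1}], [D_{m-1}^{d-1}] divides [p^d].  This makes
    [D_j / D_{j+1}^{1/d}] a root of a monic integral polynomial with constant term
    [-1], whence [D_{j+1} ~ D_j^d] for [j < m - 1] and
    [(zeta - 1) a_{m-1} ~ a_n^(d^(m-1))].  Raising to the power [p^r (p-1)] and
    using [(zeta - 1)^(p^r (p-1)) ~ p] concludes. *)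

From HB Require Import structures.
Require Import Defs.
From mathcomp Require Import ring zify.

Set Implicit Arguments.
Unset Strict Implicit.
Unset Printing Implicit Defensive.

Import GRing.Theory.
Local Open Scope ring_scope.

(** * Divisibility, associates and ideals in the ring of algebraic integers *)

Section AlgebraicIntegers.
Variable F : fieldType.
Implicit Types x y z u v : F.

(** Integrality is made a boolean predicate so that the closure lemmas for subrings apply to it. *)
Definition algint : {pred F} := fun x => `[< integralOver (intr : int -> F) x >].

Lemma algintP x : reflect (integralOver (intr : int -> F) x) (x \in algint).
Proof. exact: asboolP. Qed.

Lemma algint_subring : subring_closed algint.
Proof.
split=> [|x y /algintP xA /algintP yA|x y /algintP xA /algintP yA].
- exact/algintP/integral1.
- exact/algintP/integral_sub.
- exact/algintP/integral_mul.
Qed.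
HB.instance Definition _ := GRing.isSubringClosed.Build F algint algint_subring.

(** By transitivity of integrality: [x] is a root of a monic polynomial whose coefficients are
    themselves integral over the integers. *)
Lemma algint_monic_rel n (b : nat -> F) x :
  (forall k, (k < n)%N -> b k \in algint) ->
  x ^+ n = \sum_(k < n) b k * x ^+ k -> x \in algint.
Proof.
move=> bA xn; apply/algintP.
have sz : (size (- \poly_(k < n) b k) < n.+1)%N by rewrite size_polyN ltnS size_poly.
apply: (@integral_root_monic _ _ _ _ ('X^n - \poly_(k < n) b k)).
- by rewrite monicE lead_coefDl ?size_polyXn // lead_coefXn.
- by rewrite rootE !hornerE horner_poly xn subrr.
apply/integral_poly => i; rewrite coefB coefXn coef_poly; apply/algintP.
rewrite rpredB ?rpred_nat //; case: ifP => [/bA //|_]; exact: rpred0.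
Qed.

Lemma algint_root n x : (0 < n)%N -> x ^+ n \in algint -> x \in algint.
Proof.
case: n => // n _ xnA;
  apply: (@algint_monic_rel n.+1 (fun k => if k is 0%N then x ^+ n.+1 else 0)).
  by case=> // k _; apply: rpred0.
by rewrite big_ord_recl big1 ?addr0 ?mulr1 // => k _; rewrite mul0r.
Qed.

(** The quotient may be any algebraic integer of [F], not just one in $\mathbb{Q}(c_0)$; this leaves
    room for auxiliary elements such as $d$-th roots. *)
Definition advd x y : Prop := exists2 z, z \in algint & y = x * z.

Definition aassoc x y : Prop := advd x y /\ advd y x.

Lemma advd_refl x : advd x x.
Proof. by exists 1; rewrite ?mulr1 ?rpred1. Qed.

Lemma advd1 x : x \in algint -> advd 1 x.
Proof. by exists x; rewrite ?mul1r. Qed.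

Lemma advd_trans y x z : advd x y -> advd y z -> advd x z.
Proof. by move=> [u uA ->] [v vA ->]; exists (u * v); rewrite ?mulrA ?rpredM. Qed.

Lemma advdM x y u v : advd x y -> advd u v -> advd (x * u) (y * v).
Proof.
by move=> [a aA ->] [b bA ->]; exists (a * b); rewrite ?rpredM // mulrACA.
Qed.

Lemma advdX n x y : advd x y -> advd (x ^+ n) (y ^+ n).
Proof. by move=> [a aA ->]; exists (a ^+ n); rewrite ?rpredX // exprMn. Qed.

Lemma advd_mulr z x y : z \in algint -> advd x y -> advd x (y * z).
Proof. by move=> zA [a aA ->]; exists (a * z); rewrite ?rpredM // mulrA. Qed.

Lemma advd_mull z x y : z \in algint -> advd x y -> advd x (z * y).
Proof. by rewrite mulrC; apply: advd_mulr. Qed.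

Lemma advdD x y z : advd x y -> advd x z -> advd x (y + z).
Proof. by move=> [a aA ->] [b bA ->]; exists (a + b); rewrite ?rpredD // mulrDr. Qed.

Lemma advdB x y z : advd x y -> advd x z -> advd x (y - z).
Proof. by move=> [a aA ->] [b bA ->]; exists (a - b); rewrite ?rpredB // mulrBr. Qed.

Lemma advd_mul2r z x y : z != 0 -> advd (x * z) (y * z) -> advd x y.
Proof.
move=> z0 [a aA E]; exists a => //; apply: (mulIf z0).
by rewrite E mulrAC.
Qed.

Lemma advd_exp n k x : x \in algint -> (n <= k)%N -> advd (x ^+ n) (x ^+ k).
Proof.
by move=> xA nk; exists (x ^+ (k - n)); rewrite ?rpredX // -exprD subnKC.
Qed.

Lemma advd_expr n x : (0 < n)%N -> x \in algint -> advd x (x ^+ n).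
Proof. by move=> n0 xA; rewrite -{1}(expr1 x); apply: advd_exp. Qed.

Lemma aassoc_refl x : aassoc x x.
Proof. by split; apply: advd_refl. Qed.

Lemma aassocN x : aassoc x (- x).
Proof.
by split; exists (-1); rewrite ?rpredN ?rpred1 // mulrN1 ?opprK.
Qed.

Lemma aassoc_sym x y : aassoc x y -> aassoc y x.
Proof. by case. Qed.

Lemma aassoc_trans y x z : aassoc x y -> aassoc y z -> aassoc x z.
Proof. by move=> [xy yx] [yz zy]; split; apply: (advd_trans (y := y)). Qed.

Lemma aassocM x y u v : aassoc x y -> aassoc u v -> aassoc (x * u) (y * v).
Proof. by move=> [xy yx] [uv vu]; split; apply: advdM. Qed.

Lemma aassocX n x y : aassoc x y -> aassoc (x ^+ n) (y ^+ n).
Proof. by move=> [xy yx]; split; apply: advdX. Qed.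

Lemma aassoc_mul2r z x y : z != 0 -> aassoc (x * z) (y * z) -> aassoc x y.
Proof. by move=> z0 [xy yx]; split; apply: (advd_mul2r z0). Qed.

Lemma aassoc_prod (I : Type) (r : seq I) (P : pred I) (f g : I -> F) :
  (forall i, P i -> aassoc (f i) (g i)) ->
  aassoc (\prod_(i <- r | P i) f i) (\prod_(i <- r | P i) g i).
Proof.
by move=> fg; apply: big_ind2 => //; [apply: aassoc_refl|exact: aassocM].
Qed.

Definition is_aideal (J : F -> Prop) : Prop :=
  (forall x y, J x -> J y -> J (x - y)) /\
  (forall z x, z \in algint -> J x -> J (z * x)).

Lemma advd_ideal x : is_aideal (advd x).
Proof. by split=> [y z|z y]; [apply: advdB | apply: advd_mull]. Qed.

Definition agen2 x y z : Prop :=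
  exists s t, [/\ s \in algint, t \in algint & z = s * x + t * y].

Lemma agen2_ideal x y : is_aideal (agen2 x y).
Proof.
split=> [_ _ [s [t [sA tA ->]]] [s' [t' [sA' tA' ->]]]|z _ zA [s [t [sA tA ->]]]].
  by exists (s - s'), (t - t'); rewrite !rpredB //; split=> //; ring.
by exists (z * s), (z * t); rewrite !rpredM //; split=> //; ring.
Qed.

Lemma agen2_l x y : agen2 x y x.
Proof. by exists 1, 0; rewrite rpred1 rpred0 mul1r mul0r addr0. Qed.

Lemma agen2_r x y : agen2 x y y.
Proof. by exists 0, 1; rewrite rpred1 rpred0 mul1r mul0r add0r. Qed.

Definition acoprime x y : Prop := agen2 x y 1.

Lemma acoprime_Gauss x y z :
  z \in algint -> acoprime x y -> advd x (z * y) -> advd x z.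
Proof.
move=> zA [s [t [sA tA E]]] xzy.
have -> : z = z * s * x + t * (z * y) by rewrite -[LHS]mulr1 E; ring.
by apply: advdD; apply: advd_mull => //; [rewrite rpredM|exact: advd_refl].
Qed.

End AlgebraicIntegers.

Arguments algint {F} _.

(** * Differences of $d$-th powers for $d = p^e$ *)

(** In $k\binom{p^e}{k} = p^e\binom{p^e-1}{k-1}$, a binomial prime to $p$ would force $p^e \mid k$,
    against $0 < k < p^e$. *)
Lemma dvdn_prime_bin p e k :
  prime p -> (0 < k < p ^ e)%N -> (p %| 'C(p ^ e, k))%N.
Proof.
move=> pp; case: k => // k /= kd; apply/negPn/negP => npC.
have: (p ^ e %| k.+1 * 'C(p ^ e, k.+1))%N by rewrite -mul_bin_diag dvdn_mulr.
rewrite Gauss_dvdl; last by rewrite coprimeXl // prime_coprime.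
by move/(dvdn_leq (ltn0Sn _)); rewrite leqNgt kd.
Qed.

Lemma exprDn_prime_power (F : fieldType) p e (x y : F) (d := (p ^ e)%N) :
  prime p ->
  (x + y) ^+ d - x ^+ d = y ^+ d +
    p%:R * \sum_(k < d.-1) ('C(d, k.+1) %/ p)%:R * x ^+ (d.-1 - k) * y ^+ k.+1.
Proof.
move=> pp; have d0 : (0 < d)%N by rewrite expn_gt0 prime_gt0.
rewrite exprDn -(prednK d0) big_ord_recl big_ord_recr /= subn0 subnn bin0 binn.
rewrite !expr0 !mulr1 !mulr1n mul1r [LHS]addrC addKr addrC; congr (_ + _);
  rewrite mulr_sumr; apply: eq_bigr => k _.
have dv : (p %| 'C(d.-1.+1, k.+1))%N.
  by rewrite prednK // dvdn_prime_bin // -/d -ltn_predRL ltn_ord.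
rewrite /bump /= add1n subSS -[in LHS](divnK dv) -[LHS]mulr_natr natrM.
by ring.
Qed.

Lemma exprDn_prime_power_factor (F : fieldType) p e (x y : F) (d := (p ^ e)%N) :
  prime p -> x \in algint -> y \in algint ->
  exists2 s, s \in algint
           & (x + y) ^+ d - x ^+ d = y * (y ^+ d.-1 + p%:R * s).
Proof.
move=> pp xA yA; have d0 : (0 < d)%N by rewrite expn_gt0 prime_gt0.
exists (\sum_(k < d.-1) ('C(d, k.+1) %/ p)%:R * x ^+ (d.-1 - k) * y ^+ k).
  by apply: rpred_sum => k _; rewrite !rpredM ?rpred_nat ?rpredX.
rewrite exprDn_prime_power // mulrDr -exprS prednK //; congr (_ + _).
rewrite mulrCA [y * _]mulr_sumr; congr (_ * _); apply: eq_bigr => k _.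
by rewrite exprS; ring.
Qed.

(* With delta ^+ d = D, the quotient w = y / delta satisfies a monic equation
   with integral coefficients and constant term -1, hence is a unit. *)
Lemma exprDn_sub_assoc (C : closedFieldType) p e (x y : C) (d := (p ^ e)%N) :
  prime p -> x \in algint -> y \in algint ->
  (x + y) ^+ d - x ^+ d != 0 ->
  advd (((x + y) ^+ d - x ^+ d) ^+ d.-1) (p%:R ^+ d) ->
  aassoc ((x + y) ^+ d - x ^+ d) (y ^+ d).
Proof.
move=> pp xA yA; have d0 : (0 < d)%N by rewrite expn_gt0 prime_gt0.
have := @exprDn_prime_power C p e x y pp; rewrite -/d.
move: (_ - _) => D DE Dn0 Ddvd.
have DA : D \in algint.
  rewrite DE rpredD ?rpredX // rpredM ?rpred_nat //.
  by apply: rpred_sum => k _; rewrite !rpredM ?rpred_nat ?rpredX.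
have [delta deltaE] : exists delta : C, delta ^+ d = D.
  have [u uE] := @solve_monicpoly C d (fun k => if k is 0%N then D else 0) d0.
  exists u; rewrite uE -(prednK d0) big_ord_recl big1 ?addr0 ?mulr1 // => k _.
  by rewrite mul0r.
have delta0 : delta != 0.
  by apply: contraNneq Dn0 => z; rewrite -deltaE z expr0n gtn_eqF.
have deltaA : delta \in algint by apply: (algint_root d0); rewrite deltaE.
(* The $d$-th power of $p/\delta^{d-1}$ is $p^d/D^{d-1}$, integral by hypothesis. *)
have [pi piA piE] : exists2 pi, pi \in algint & p%:R = pi * delta ^+ d.-1.
  exists (p%:R / delta ^+ d.-1); last by rewrite divfK // expf_neq0.
  apply: (algint_root d0); rewrite expr_div_n exprAC deltaE.
  by case: Ddvd => z zA ->; rewrite mulrAC mulfV ?mul1r // expf_neq0.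
have [w yE] : exists w, y = delta * w by exists (y / delta); rewrite mulrC divfK.
pose b k := ('C(d, k.+1) %/ p)%:R * x ^+ (d.-1 - k) * (pi * delta ^+ k).
have bA k : b k \in algint by rewrite !rpredM ?rpred_nat ?rpredX.
(* Divide the binomial expansion by $D = \delta^d$: in each middle term $p$ supplies $\delta^{d-1}$
   and $y^{k+1}$ supplies one more $\delta$. *)
have wE : w ^+ d = 1 - \sum_(k < d.-1) b k * w ^+ k.+1.
  apply: (mulfI Dn0); rewrite mulrBr mulr1 -{1}deltaE -exprMn -yE.
  apply: (canRL (addrK _)); rewrite [RHS]DE; congr (_ + _).
  rewrite !mulr_sumr; apply: eq_bigr => k _.
  have {1}-> : D = delta * delta ^+ d.-1 by rewrite -exprS prednK.
  by rewrite /b [in RHS]yE [(_ * _) ^+ k.+1]exprMn piE [delta ^+ k.+1]exprS; ring.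
have wA : w \in algint.
  apply: (@algint_monic_rel _ d (fun k => if k is k'.+1 then - b k' else 1)).
    by case=> [|k] _; rewrite ?rpred1 ?rpredN.
  rewrite wE -[in RHS](prednK d0) big_ord_recl /= mulr1 -sumrN; congr (_ + _).
  by apply: eq_bigr => k _; rewrite mulNr.
(* Every term of [wE] other than the constant 1 has a factor [w], so the cofactor is an explicit
   inverse. *)
have w1 : advd w 1.
  exists (w ^+ d.-1 + \sum_(k < d.-1) b k * w ^+ k).
    by rewrite rpredD ?rpredX // rpred_sum // => k _; rewrite rpredM ?rpredX.
  rewrite mulrDr -exprS prednK // wE mulr_sumr -addrA
    [X in _ = _ + X](_ : _ = 0) ?addr0 //.
  by rewrite addrC; apply/eqP; rewrite subr_eq0; apply/eqP;
    apply: eq_bigr => k _; rewrite exprS; ring.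
have wu : aassoc 1 (w ^+ d).
  by split; [apply/advd1/rpredX | rewrite -[1](expr1n C d); apply: advdX].
by rewrite yE exprMn deltaE -[X in aassoc X _]mulr1; apply: aassocM => //;
  apply: aassoc_refl.
Qed.

(** * Roots of unity and the factorization of $p$ *)

Section RootsOfUnity.
Variable F : fieldType.
Implicit Types z : F.

Lemma algint_unity n z : (0 < n)%N -> z ^+ n = 1 -> z \in algint.
Proof. by move=> n0 zn; apply: (algint_root n0); rewrite zn rpred1. Qed.

Lemma advd_unity n z : (0 < n)%N -> z ^+ n = 1 -> advd z 1.
Proof.
move=> n0 zn; exists (z ^+ n.-1); first by rewrite rpredX // (algint_unity n0).
by rewrite -exprS prednK.
Qed.

Lemma advd_1subX i z : z \in algint -> advd (1 - z) (1 - z ^+ i).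
Proof.
move=> zA; exists (\sum_(k < i) z ^+ k); last by rewrite -opprB subrX1 -mulNr opprB.
by apply: rpred_sum => k _; apply: rpredX.
Qed.

(** By Bezout, [z] is also a power of [z ^+ i], so [advd_1subX] applies in both directions. *)
Lemma aassoc_1subX n i z : (0 < n)%N -> (0 < i)%N -> z ^+ n = 1 -> coprime i n ->
  aassoc (1 - z) (1 - z ^+ i).
Proof.
move=> n0 i0 zn; rewrite /coprime => /eqP g1.
have zA := algint_unity n0 zn; split; first exact: advd_1subX.
case: (egcdnP n i0) => km kn E _; rewrite g1 in E.
have {2}-> : z = (z ^+ i) ^+ km.
  by rewrite -exprM mulnC E exprD mulnC exprM zn expr1n mul1r.
by apply: advd_1subX; apply: rpredX.
Qed.

(** Evaluate $(X^n-1)/(X-1)$ at 1, once as a product and once as a geometric sum. *)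
Lemma prod_1sub_prim n z : n.-primitive_root z ->
  \prod_(1 <= i < n) (1 - z ^+ i) = n%:R.
Proof.
move=> zn; have n0 := prim_order_gt0 zn; have := factor_Xn_sub_1 zn.
rewrite big_ltn // expr0 subrX1 => /(mulfI (negbT (polyXsubC_eq0 1))).
move/(congr1 (fun q : {poly F} => q.[1])).
rewrite horner_prod horner_sum [X in _ = X -> _](eq_bigr (fun=> 1)); last first.
  by move=> i _; rewrite hornerXn expr1n.
by rewrite sumr_const card_ord => <-; apply: eq_bigr => i _; rewrite !hornerE.
Qed.

Lemma aassoc_1sub_prim p r z : prime p -> (p ^ r.+1).-primitive_root z ->
  aassoc ((1 - z) ^+ (p ^ r * (p - 1))) p%:R.
Proof.
move=> pp zq; set q := (p ^ r.+1)%N in zq.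
have q0 : (0 < q)%N := prim_order_gt0 zq.
have zq1 : z ^+ q = 1 := prim_expr_order zq.
have zA := algint_unity q0 zq1.
have z1 : aassoc 1 z by split; [apply: advd1 | apply: (advd_unity q0)].
have zp : (p ^ r).-primitive_root (z ^+ p).
  have {2}-> : (p = q %/ p ^ r)%N by rewrite /q expnSr mulKn ?expn_gt0 ?prime_gt0.
  by apply: dvdn_prim_root => //; rewrite /q expnS dvdn_mull.
have zpr : p.-primitive_root (z ^+ (p ^ r)).
  have -> : (p ^ r = q %/ p)%N by rewrite /q expnS mulKn ?prime_gt0.
  by apply: dvdn_prim_root => //; rewrite /q expnS dvdn_mulr.
(* Evaluating $X^{p^r} - 1 = \prod_k (X - z^{pk})$ at $z$ gives $p^r$ factors, each associate to $1
   - z$. *)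
have A1 : aassoc ((1 - z) ^+ (p ^ r)) (1 - z ^+ (p ^ r)).
  have := congr1 (fun f : {poly F} => f.[z]) (factor_Xn_sub_1 zp).
  rewrite horner_prod big_mkord !hornerE => E.
  apply: (aassoc_trans (y := z ^+ (p ^ r) - 1)); last first.
    by rewrite -[1 - _ ^+ (p ^ r)]opprB; apply: aassocN.
  rewrite -E -[in X in aassoc X _](card_ord (p ^ r)) -prodr_const.
  apply: aassoc_prod => k _; rewrite !hornerE -exprM.
  have pr0 : (0 < p ^ r)%N by rewrite expn_gt0 prime_gt0.
  have p1 := prime_gt1 pp.
  have q1 : (0 < p * (k + p ^ r))%N by nia.
  (* The exponent $pk - 1$ is prime to $p$; the shift by $p \cdot p^r$, the order of $z$, keeps it a
     natural number when $k = 0$. *)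
  have -> : z - z ^+ (p * k) = z * (1 - z ^+ (p * (k + p ^ r)).-1).
    rewrite mulrBr mulr1; congr (_ - _).
    by rewrite -exprS prednK // mulnDr -expnS exprD zq1 mulr1.
  rewrite -[1 - z]mul1r; apply: aassocM => //.
  have t0 : (0 < (p * (k + p ^ r)).-1)%N by nia.
  apply: (aassoc_1subX q0 t0 zq1); rewrite /q coprimeXr //.
  by apply: coprime_dvdr (coprimePn _) => //; rewrite dvdn_mulr.
rewrite exprM; apply: (aassoc_trans (aassocX _ A1)).
rewrite -(prod_1sub_prim zpr) -prodr_const_nat.
rewrite big_nat [X in aassoc _ X]big_nat; apply: aassoc_prod => i /andP[i0 ip].
apply: (aassoc_1subX (prime_gt0 pp)) => //; first exact: prim_expr_order.
by rewrite coprime_sym prime_coprime // gtnNdvd.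
Qed.

End RootsOfUnity.

(** * Sums in ideals given as predicates *)

Section IdealClosure.
Variables (F : fieldType) (J : F -> Prop).
Hypothesis idJ : is_aideal J.

Lemma aideal0 x : J x -> J 0.
Proof. by move=> Jx; rewrite -(subrr x); apply: idJ.1. Qed.

Lemma aidealD x y : J x -> J y -> J (x + y).
Proof.
move=> Jx Jy; rewrite -[y]opprK -[- y]add0r; apply: idJ.1 => //.
by apply: idJ.1 => //; apply: aideal0 Jx.
Qed.

End IdealClosure.

(** * The critical orbit and its periods modulo an ideal *)

Section CriticalOrbit.
Variables (F : fieldType) (d : nat) (c : F).
Local Notation a := (crit_orbit d c).

Lemma crit_orbitS i : a i.+1 = a i ^+ d + c.
Proof. by []. Qed.

Lemma crit_orbit_subS i j : a i.+1 - a j.+1 = a i ^+ d - a j ^+ d.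
Proof. by rewrite !crit_orbitS opprD addrACA subrr addr0. Qed.

Lemma crit_orbit_eqD i j k : a i = a j -> a (k + i) = a (k + j).
Proof. by move=> E; rewrite /crit_orbit !iterD -/(a i) -/(a j) E. Qed.

Lemma horner_crit_orbit i :
  (map_poly (intr : int -> F) (crit_orbit d 'X i)).[c] = a i.
Proof.
elim: i => [|i IH]; first by rewrite /crit_orbit /= rmorph0 horner0.
have -> : crit_orbit d 'X i.+1 = crit_orbit d 'X i ^+ d + 'X :> {poly int} by [].
by rewrite rmorphD rmorphXn /= map_polyX !hornerE IH.
Qed.

(** In passing from $P$ to $P^d + X$ with $d \geq 2$, the summand $X$ stays below the leading
    term. *)
Lemma crit_orbit_poly_monic i : (1 < d)%N ->
  (crit_orbit d 'X i.+1 \is @monic int) /\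
  size (crit_orbit d 'X i.+1 : {poly int}) = (d ^ i).+1.
Proof.
move=> d1; elim: i => [|i [mon sz]].
  have -> : crit_orbit d 'X 1 = 'X :> {poly int}.
    by rewrite /crit_orbit /= /unicritical expr0n; case: d d1 => //= ? _;
      rewrite add0r.
  by rewrite monicX size_polyX.
have -> : crit_orbit d 'X i.+2 = crit_orbit d 'X i.+1 ^+ d + 'X :> {poly int} by [].
set P := crit_orbit d 'X i.+1 in mon sz *.
have szP : size (P ^+ d) = (d ^ i.+1).+1.
  have : (size (P ^+ d)).-1 = (d ^ i.+1)%N by rewrite size_exp sz expnSr.
  have : (0 < size (P ^+ d))%N by rewrite size_poly_gt0 monic_neq0 ?monic_exp.
  by lia.
have lt : (size ('X : {poly int}) < size (P ^+ d))%N.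
  by rewrite size_polyX szP ltnS (leq_trans d1) // expnS leq_pmulr // expn_gt0 (ltnW d1).
split; last by rewrite size_polyDl.
by rewrite monicE lead_coefDl // lead_coef_exp (monicP mon) expr1n.
Qed.

(** The parameter is a root of $a_{m+n} - a_m$, which is monic because $d^{m+n-1} > d^{m-1}$. *)
Lemma crit_orbit_algint_param m n : (1 < d)%N -> (0 < m)%N -> (0 < n)%N ->
  a (m + n) = a m -> c \in algint.
Proof.
move=> d1 m0 n0 E; apply/algintP.
exists (crit_orbit d 'X (m + n) - crit_orbit d 'X m); last first.
  by rewrite rmorphB rootE hornerD hornerN !horner_crit_orbit E subrr.
case: m m0 {E} => // m _; rewrite addSn.
have [mon1 sz1] := crit_orbit_poly_monic (m + n) d1.
have [mon2 sz2] := crit_orbit_poly_monic m d1.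
rewrite monicE lead_coefDl ?(monicP mon1) //.
by rewrite size_polyN sz1 sz2 ltnS ltn_exp2l // -[X in (X < _)%N]addn0 ltn_add2l.
Qed.

Hypothesis cA : c \in algint.

Lemma crit_orbit_algint i : a i \in algint.
Proof.
by elim: i => [|i IH]; [apply: rpred0 | rewrite crit_orbitS rpredD ?rpredX].
Qed.
Local Hint Resolve crit_orbit_algint : core.

Lemma advd_crit_orbit_sub i j : advd (a i - a j) (a i.+1 - a j.+1).
Proof.
rewrite crit_orbit_subS subrXX; apply: advd_mulr; last exact: advd_refl.
by apply: rpred_sum => k _; rewrite rpredM ?rpredX.
Qed.

Lemma advd_crit_orbit_sub_le i j k l : (k <= l)%N ->
  advd (a (k + i) - a (k + j)) (a (l + i) - a (l + j)).
Proof.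
move=> /subnK <-; elim: (l - k)%N => [|h IH]; first exact: advd_refl.
exact: advd_trans IH (advd_crit_orbit_sub _ _).
Qed.

(** The congruence is required from index 0 on: this is pure periodicity modulo [J], with no
    tail. *)
Definition orbit_period (J : F -> Prop) k : Prop := forall j, J (a (j + k) - a j).

Section Periods.
Variable J : F -> Prop.
Hypothesis idJ : is_aideal J.
Local Notation period := (orbit_period J).

(** Since $a_0 = 0$, the element $a_k = a_k - a_0$ divides every later difference $a_{j+k} -
    a_j$. *)
Lemma orbit_periodP k : J (a k) <-> period k.
Proof.
split=> [Jk j|/(_ 0%N)]; last by rewrite add0n subr0.
have : advd (a k - a 0) (a (j + k) - a (j + 0)).
  exact: (@advd_crit_orbit_sub_le k 0 0 j).
by rewrite addn0 subr0 => -[z zA ->]; rewrite mulrC; apply: idJ.2.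
Qed.

Lemma orbit_periodD k l : period k -> period l -> period (k + l).
Proof.
move=> Pk Pl j; rewrite addnA -(subrK (a (j + k)) (a _)) -addrA.
exact: aidealD.
Qed.

Lemma orbit_periodB k l : period (k + l) -> period k -> period l.
Proof.
move=> Pkl Pk j.
have -> : a (j + l) - a j = (a (j + (k + l)) - a j) - (a (j + l + k) - a (j + l)).
  by rewrite -addnA (addnC l); ring.
exact: idJ.1.
Qed.

Lemma orbit_periodM i k : period k -> period (i * k).
Proof.
move=> Pk; elim: i => [|i IH]; last by rewrite mulSn; apply: orbit_periodD.
by move=> j; rewrite mul0n addn0 subrr; apply: (aideal0 idJ (Pk 0%N)).
Qed.

Lemma orbit_period_gcd k l : (0 < k)%N -> period k -> period l -> period (gcdn k l).
Proof.
move=> k0 Pk Pl; case: (egcdnP l k0) => u v E _.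
apply: (@orbit_periodB (v * l)); last exact: orbit_periodM.
by rewrite -E; apply: orbit_periodM.
Qed.

End Periods.

Lemma advd_crit_orbit_mul k i : advd (a k) (a (i * k)).
Proof.
have idk := advd_ideal (a k).
by apply/(orbit_periodP idk)/(orbit_periodM idk)/(orbit_periodP idk)/advd_refl.
Qed.

Lemma advd_crit_orbit_dvd k i : (k %| i)%N -> advd (a k) (a i).
Proof. by move=> /dvdnP[j ->]; apply: advd_crit_orbit_mul. Qed.

Lemma advd_crit_orbit_exp k j : (0 < d)%N -> (0 < j)%N ->
  advd (a k ^+ d) (a (j + k) - a j).
Proof.
move=> d0 j0.
(* As $a_1 = c$, the power $a_k^d$ is the difference $a_{k+1} - a_1$, which divides those with $j
   \geq 1$. *)
have -> : a k ^+ d = a (1 + k) - a (1 + 0).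
  rewrite !add1n crit_orbit_subS /crit_orbit /= expr0n.
  by case: d d0 => //= ? _; rewrite subr0.
by rewrite -{2}[j]addn0; apply: advd_crit_orbit_sub_le.
Qed.

(** Telescopes along the multiples of [k]; [advd_crit_orbit_exp] handles each increment. *)
Lemma advd_crit_orbit_exp_mul k i : (0 < d)%N -> (0 < k)%N -> (0 < i)%N ->
  advd (a k ^+ d) (a (i * k) - a k).
Proof.
move=> d0 k0; case: i => // i _; elim: i => [|i IH].
  by rewrite mul1n subrr; exists 0; rewrite ?mulr0 ?rpred0.
have -> : a (i.+2 * k) - a k = (a (i.+1 * k + k) - a (i.+1 * k)) + (a (i.+1 * k) - a k).
  by rewrite -mulSnr; ring.
by apply: advdD => //; apply: advd_crit_orbit_exp; rewrite // muln_gt0.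
Qed.

End CriticalOrbit.

(** * Postcritically finite parameters and the root of unity [zeta] *)

Section PostcriticallyFinite.
Variables (C : closedFieldType) (p e m n : nat) (c : C).
Hypotheses (pp : prime p) (e_gt0 : (0 < e)%N) (m_gt0 : (0 < m)%N).
Hypothesis pcf : pcf_exact_type (p ^ e) c m n.
Local Notation d := (p ^ e)%N.
Local Notation a := (crit_orbit d c).
Local Notation zeta := (a (m + n - 1) / a (m - 1)).

Lemma pcf_period_gt0 : (0 < n)%N. Proof. by case: pcf. Qed.
Let n_gt0 := pcf_period_gt0.

Lemma pcf_degree_gt1 : (1 < d)%N.
Proof. by rewrite -(exp1n e) ltn_exp2r ?prime_gt1. Qed.
Let d_gt1 := pcf_degree_gt1.
Let d_gt0 : (0 < d)%N := ltnW d_gt1.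

Lemma pcf_param_algint : c \in algint.
Proof. by case: pcf => n0 E _; apply: crit_orbit_algint_param E. Qed.
Let cA := pcf_param_algint.
Let aA i : a i \in algint := crit_orbit_algint d cA i.

Lemma pcf_periodic j : (m <= j)%N -> a (j + n) = a j.
Proof.
move=> mj; have [_ E _] := pcf.
by rewrite -(subnK mj) -addnA; apply: crit_orbit_eqD.
Qed.

Lemma pcf_neq_tail k j : (0 < k)%N -> a (j + k) = a j -> (m <= j)%N.
Proof. by move=> k0 E; have [_ _ /(_ _ _ k0 E)[]] := pcf. Qed.

Lemma pcf_neq_period k j : (0 < k < n)%N -> a (j + k) <> a j.
Proof.
move=> /andP[k0 kn] E; have [_ _ /(_ _ _ k0 E)[_]] := pcf.
by rewrite leqNgt kn.
Qed.

(** A return to 0 would make 0 periodic, that is, of tail length 0. *)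
Lemma pcf_orbit_neq0 i : (0 < i)%N -> a i != 0.
Proof.
move=> i0; apply/eqP => ai0.
by have := @pcf_neq_tail i 0 i0; rewrite add0n leqNgt m_gt0 => /(_ ai0).
Qed.

Lemma pcf_tail_pow : a (m - 1 + n) ^+ d = a (m - 1) ^+ d.
Proof.
have [_ E _] := pcf; apply: (addIr c).
by rewrite -!crit_orbitS -addSn subn1 prednK.
Qed.

(** For $m = 1$, [pcf_tail_pow] would read $a_n^d = a_0^d = 0$. *)
Lemma pcf_tail_gt1 : (1 < m)%N.
Proof.
rewrite ltn_neqAle m_gt0 andbT; apply/eqP => m1.
have := pcf_tail_pow; rewrite -m1 subnn add0n [a 0](_ : _ = 0) //.
by rewrite expr0n gtn_eqF // => /eqP;
  rewrite expf_eq0 d_gt0 /= (negPf (pcf_orbit_neq0 _)).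
Qed.
Let m1_gt0 : (0 < m - 1)%N. Proof. by rewrite subn_gt0 pcf_tail_gt1. Qed.
Let am_neq0 : a (m - 1) != 0 := pcf_orbit_neq0 m1_gt0.

Let mnE : (m + n - 1 = m - 1 + n)%N. Proof. by rewrite addnBAC. Qed.

Lemma pcf_zeta_unity : zeta ^+ d = 1.
Proof. by rewrite expr_div_n mnE pcf_tail_pow mulfV // expf_neq0. Qed.

Lemma pcf_zeta_neq1 : zeta <> 1.
Proof.
rewrite mnE => /divr1_eq /(pcf_neq_tail n_gt0).
by rewrite leqNgt ltn_subrL m_gt0.
Qed.

Lemma pcf_zeta_order : exists r, [/\ (r <= e - 1)%N, zeta ^+ (p ^ r.+1) = 1,
  forall s, zeta ^+ (p ^ s.+1) = 1 -> (r <= s)%N & (p ^ r.+1).-primitive_root zeta].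
Proof.
have eE : (e - 1).+1 = e by lia.
have ex : exists r, zeta ^+ (p ^ r.+1) == 1.
  by exists (e - 1)%N; rewrite eE pcf_zeta_unity.
case: (ex_minnP ex) => r /eqP rE rmin.
have rmin' s : zeta ^+ (p ^ s.+1) = 1 -> (r <= s)%N by move=> /eqP/rmin.
exists r; split=> //; first by apply: rmin'; rewrite eE pcf_zeta_unity.
have q_gt0 : (0 < p ^ r.+1)%N by rewrite expn_gt0 prime_gt0.
(* The order of [zeta] is a power of $p$; exponent 0 is excluded by [pcf_zeta_neq1], and minimality
   of [r] fixes the rest. *)
have [k kz /(dvdn_pfactor k r.+1 pp)[[|s] sr kE]] := prim_order_exists q_gt0 rE.
  by have := prim_expr_order kz; rewrite kE expr1 => /pcf_zeta_neq1.
suff -> : r = s by rewrite -kE.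
apply/eqP; rewrite eqn_leq -[(s <= r)%N]ltnS sr andbT.
by apply: rmin'; rewrite -kE prim_expr_order.
Qed.

(** * The element [zeta - 1], and the units in the critical orbit *)

Variable r : nat.
Hypothesis zetaP : (p ^ r.+1).-primitive_root zeta.
Local Notation N := (p ^ r * (p - 1))%N.

Let N_gt0 : (0 < N)%N.
Proof. by rewrite muln_gt0 expn_gt0 prime_gt0 // subn_gt0 prime_gt1. Qed.

Let zetaA : zeta \in algint := algint_unity d_gt0 pcf_zeta_unity.

Lemma pcf_zeta_assoc : aassoc ((zeta - 1) ^+ N) p%:R.
Proof.
apply: aassoc_trans (aassoc_1sub_prim pp zetaP); apply: aassocX.
by rewrite -[1 - _]opprB; apply: aassocN.
Qed.

Lemma pcf_zeta_dvd : advd (zeta - 1) p%:R.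
Proof.
apply: (advd_trans (y := (zeta - 1) ^+ N)) pcf_zeta_assoc.1.
by apply: advd_expr => //; rewrite rpredB ?rpred1.
Qed.

Lemma pcf_diff_zeta : a (m - 1 + n) - a (m - 1) = (zeta - 1) * a (m - 1).
Proof. by rewrite mulrBl divfK // mul1r mnE. Qed.

(** Jumping ahead by $mi \geq m$ steps lands on the cycle, where $n$ is a true period, and such
    jumps are trivial modulo [J]. *)
Lemma crit_orbit_period_n J i : is_aideal J -> (0 < i)%N ->
  orbit_period d c J i -> orbit_period d c J n.
Proof.
move=> idJ i0 Pi j; have Pmi := orbit_periodM idJ m Pi.
have E : a (j + n + m * i) = a (j + m * i).
  by rewrite addnAC pcf_periodic // (leq_trans (leq_pmulr m i0)) ?leq_addl.
have -> : a (j + n) - a j =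
    (a (j + m * i) - a j) - (a (j + n + m * i) - a (j + n)) by rewrite E; ring.
exact: idJ.1.
Qed.

Lemma crit_orbit_gcd_ideal J i : is_aideal J -> (0 < i)%N ->
  J (a i) -> J (a (gcdn i n)).
Proof.
move=> idJ i0 /(orbit_periodP _ cA idJ) Pi; apply/(orbit_periodP _ cA idJ).
by apply: orbit_period_gcd => //; apply: (crit_orbit_period_n idJ i0).
Qed.

Lemma crit_orbit_assoc_gcd i : (0 < i)%N -> aassoc (a i) (a (gcdn i n)).
Proof.
move=> i0; split; last exact/(advd_crit_orbit_dvd _ cA)/dvdn_gcdl.
exact: (crit_orbit_gcd_ideal (advd_ideal _) i0 (advd_refl _)).
Qed.

Lemma pcf_diff_step k j : exists2 s, s \in algint &
  a (j.+1 + k) - a j.+1 =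
    (a (j + k) - a j) * ((a (j + k) - a j) ^+ d.-1 + p%:R * s).
Proof.
have yA : a (j + k) - a j \in algint by rewrite rpredB.
have [s sA E] := exprDn_prime_power_factor e pp (aA j) yA.
by exists s; rewrite // addSn crit_orbit_subS -E [a j + _]addrC subrK.
Qed.

(* a (j + g) - a j is a nonzero periodic function of j >= m, so the cofactor of
   pcf_diff_step is a unit; it lies in the ideal (a g, p). *)
Lemma crit_orbit_coprime_p g : (0 < g < n)%N -> acoprime (a g) p%:R.
Proof.
move=> gn; have D0 : a (m + g) - a m != 0.
  by rewrite subr_eq0; apply/eqP/pcf_neq_period.
have [s sA E] := pcf_diff_step g m.
(* Going once around the cycle: the difference at index $m+n \geq m+1$ equals the one at $m$, so
   divisibility also runs backwards. *)
have [u uA uE] : advd (a (m.+1 + g) - a m.+1) (a (m + g) - a m).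
  have := @advd_crit_orbit_sub_le _ d _ cA g 0 m.+1 (m + n).
  rewrite !addn0 [(m + n + g)%N]addnAC !pcf_periodic ?leq_addr //; apply.
  by rewrite -addn1 leq_add2l.
have [v vA vE] : advd (a g) ((a (m + g) - a m) ^+ d.-1).
  apply: (advd_trans (y := a (m + g) - a m)).
    by have := @advd_crit_orbit_sub_le _ d _ cA g 0 0 m;
      rewrite !addn0 add0n subr0; apply.
  by apply: advd_expr; rewrite ?rpredB // -ltnS prednK.
(* With $D = a_{m+g} - a_m$, the relations give $D = D(a_g v + p s)u$; cancel $D$. *)
exists (v * u), (s * u); rewrite !rpredM //; split=> //.
apply: (mulfI D0); rewrite mulr1 {1}uE E vE; ring.
Qed.

(** Strong induction on [g]: the factor $a_{m-1}$ is removed from $a_g^d \mid (\zeta-1)a_{m-1}$,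
    leaving $a_g \mid \zeta - 1 \mid p$, whereas $a_g$ is prime to $p$. *)
Lemma crit_orbit_proper_unit g : (0 < g < n)%N -> (g %| n)%N -> advd (a g) 1.
Proof.
have [b] := ubnP g; elim: b g => // b IH g; rewrite ltnS => gb gn gdvd.
have [g0 _] := andP gn.
have agn : advd (a g ^+ d) ((zeta - 1) * a (m - 1)).
  rewrite -pcf_diff_zeta; apply: (advd_trans (y := a n ^+ d)).
    exact/advdX/(advd_crit_orbit_dvd _ cA).
  exact: advd_crit_orbit_exp.
suff gz : advd (a g) (zeta - 1).
  apply: (acoprime_Gauss _ (crit_orbit_coprime_p gn)); first exact: rpred1.
  by rewrite mul1r; apply: advd_trans gz pcf_zeta_dvd.
have zA : zeta - 1 \in algint by rewrite rpredB ?rpred1.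
(* If $g \mid m-1$, then $a_{m-1}$ is $a_g$ times an element congruent to 1 modulo $a_g$; cancelling
   one $a_g$ still leaves $a_g^{d-1}$ with $d - 1 \geq 1$. *)
have [gm|gm] := boolP (g %| m - 1)%N.
  have [t tA tE] : advd (a g ^+ d) (a (m - 1) - a g).
    have /dvdnP[i iE] := gm; rewrite iE; apply: advd_crit_orbit_exp_mul => //.
    by case: i iE m1_gt0 => // ->; rewrite mul0n.
  have ag0 := pcf_orbit_neq0 g0.
  have dE : a g ^+ d = a g ^+ d.-1 * a g by rewrite -exprSr prednK.
  have agE : a (m - 1) = (1 + a g ^+ d.-1 * t) * a g.
    by rewrite -[LHS](subrK (a g)) tE dE; ring.
  have gd : advd (a g) (a g ^+ d.-1) by apply: advd_expr; rewrite // -ltnS prednK.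
  have [w wA wE] := gd.
  apply: (acoprime_Gauss (y := 1 + a g ^+ d.-1 * t)) => //.
    exists (- (w * t)), 1; rewrite rpredN rpred1 rpredM //; split=> //.
    by rewrite wE; ring.
  apply: (advd_trans gd); apply: (advd_mul2r ag0).
  by rewrite -dE -mulrA -agE.
apply: (acoprime_Gauss (y := a (m - 1))) => //; last first.
  by apply: advd_trans agn; apply: advd_expr.
have idJ := agen2_ideal (a g) (a (m - 1)).
have Jl : agen2 (a g) (a (m - 1)) (a (gcdn g (m - 1))).
  apply/(orbit_periodP _ cA idJ)/(orbit_period_gcd idJ g0);
    apply/(orbit_periodP _ cA idJ).
    exact: agen2_l.
  exact: agen2_r.
(* Otherwise $\gcd(g, m-1)$ is a smaller proper divisor of $n$; its orbit element is a unit by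
   induction and lies in the ideal $(a_g, a_{m-1})$. *)
have lg : (gcdn g (m - 1) < g)%N.
  rewrite ltn_neqAle dvdn_leq ?dvdn_gcdl // andbT.
  by apply: contraNneq gm => <-; apply: dvdn_gcdr.
have [u uA uE] : advd (a (gcdn g (m - 1))) 1.
  apply: IH; first exact: leq_trans lg gb.
    by rewrite gcdn_gt0 g0 /=; case/andP: gn => _; apply: ltn_trans.
  exact: dvdn_trans (dvdn_gcdl _ _) gdvd.
by rewrite /acoprime uE mulrC; apply: idJ.2.
Qed.

Lemma crit_orbit_unit i : (0 < i)%N -> ~~ (n %| i)%N -> advd (a i) 1.
Proof.
move=> i0 ni; apply: (advd_trans (crit_orbit_assoc_gcd i0).1).
apply: crit_orbit_proper_unit; last exact: dvdn_gcdr.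
rewrite gcdn_gt0 i0 /= ltn_neqAle dvdn_leq ?dvdn_gcdr // andbT.
by apply: contraNneq ni => <-; apply: dvdn_gcdl.
Qed.

Lemma crit_orbit_assoc i : (0 < i)%N -> (n %| i)%N -> aassoc (a i) (a n).
Proof. by move=> i0 /gcdn_idPr nE; have := crit_orbit_assoc_gcd i0; rewrite nE. Qed.

(** * The exact power of [a n] associate to $p$ *)

Local Notation eps := (n %| m - 1 : nat)%N.

(** The boolean [eps], read as 0 or 1, treats cases (a) and (b) together: $a_{m-1}$ is a unit or an
    associate of $a_n$. *)
Lemma crit_orbit_tail_assoc : aassoc (a (m - 1)) (a n ^+ eps).
Proof.
case: (boolP (n %| m - 1)%N) => nm; first exact: crit_orbit_assoc.
by split; [apply: crit_orbit_unit | apply: advd1].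
Qed.

Lemma pcf_diff_assoc_zeta :
  aassoc (a (m - 1 + n) - a (m - 1)) ((zeta - 1) * a n ^+ eps).
Proof.
by rewrite pcf_diff_zeta; apply: aassocM (aassoc_refl _) crit_orbit_tail_assoc.
Qed.

Lemma pcf_diff_neq0 : a (m - 1 + n) - a (m - 1) != 0.
Proof.
rewrite pcf_diff_zeta mulf_neq0 // subr_eq0; exact/eqP/pcf_zeta_neq1.
Qed.

(** With $D = D_{m-1}$, $D^d$ divides $(\zeta-1)^d a_n^{d\,\mathrm{eps}}$, whose second factor
    divides $D$; cancelling $D$ leaves $D^{d-1} \mid (\zeta-1)^d$. *)
Lemma pcf_diff_dvd_p : advd ((a (m - 1 + n) - a (m - 1)) ^+ d.-1) (p%:R ^+ d).
Proof.
apply: (advd_trans (y := (zeta - 1) ^+ d)); last exact/advdX/pcf_zeta_dvd.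
apply: (advd_mul2r pcf_diff_neq0); rewrite -exprSr prednK //.
apply: (advd_trans (advdX d pcf_diff_assoc_zeta.1)).
rewrite exprMn; apply: advdM; first exact: advd_refl.
case: (n %| m - 1)%N; first exact: advd_crit_orbit_exp.
by rewrite expr1n; apply: advd1; rewrite rpredB.
Qed.

(** Each $D_{j+1}$ with $j < m-1$ divides $D_{m-1}$, hence inherits the bound of [pcf_diff_dvd_p]
    that [exprDn_sub_assoc] requires. *)
Lemma pcf_diff_assoc_exp j : (j <= m - 1)%N ->
  aassoc (a (j + n) - a j) (a n ^+ (d ^ j)).
Proof.
elim: j => [_|j IH jm].
  by rewrite add0n subr0 expr1; apply: aassoc_refl.
apply: (aassoc_trans (y := (a (j + n) - a j) ^+ d)); last first.
  by rewrite expnSr exprM; apply/aassocX/IH/ltnW.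
have Dd : advd (a (j.+1 + n) - a j.+1) (a (m - 1 + n) - a (m - 1)).
  by have := @advd_crit_orbit_sub_le _ d _ cA n 0 _ _ jm; rewrite !addn0.
have D0 : a (j.+1 + n) - a j.+1 != 0.
  by apply: contraNneq pcf_diff_neq0 => D0; case: Dd => z _ ->; rewrite D0 mul0r.
have DE : a (j.+1 + n) - a j.+1 = (a j + (a (j + n) - a j)) ^+ d - a j ^+ d.
  by rewrite addSn crit_orbit_subS [a j + _]addrC subrK.
rewrite DE in Dd D0 *; apply: exprDn_sub_assoc => //; first by rewrite rpredB.
exact: advd_trans (advdX _ Dd) pcf_diff_dvd_p.
Qed.

(** Compares the two descriptions of $D_{m-1}$, as $a_n^{d^{m-1}}$ and as
    $(\zeta-1)a_n^{\mathrm{eps}}$, and cancels $a_n^{\mathrm{eps}}$. *)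
Lemma crit_orbit_n_assoc : aassoc (a n ^+ (N * (d ^ (m - 1) - eps))) p%:R.
Proof.
apply: aassoc_trans pcf_zeta_assoc; rewrite mulnC exprM; apply: aassocX.
apply: (aassoc_mul2r (z := a n ^+ eps)); first by rewrite expf_neq0 ?pcf_orbit_neq0.
rewrite -exprD subnK; last by rewrite (leq_trans (leq_b1 _)) // expn_gt0 d_gt0.
apply: aassoc_trans pcf_diff_assoc_zeta.
by apply: aassoc_sym; apply: pcf_diff_assoc_exp.
Qed.

Lemma crit_orbit_pow_assoc i : (0 < i)%N ->
  aassoc (a i ^+ (N * (d ^ (m - 1) - eps))) (if (n %| i)%N then p%:R else 1).
Proof.
move=> i0; case: ifPn => [ni|ni].
  exact: aassoc_trans (aassocX _ (crit_orbit_assoc i0 ni)) crit_orbit_n_assoc.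
rewrite -[1](expr1n C (N * (d ^ (m - 1) - eps))); apply: aassocX.
by split; [apply: crit_orbit_unit | apply: advd1].
Qed.

End PostcriticallyFinite.

(** * Principal ideals of the ring of integers of $\mathbb{Q}(x)$ *)

Section NumberFieldIdeals.
Variables (F : fieldType) (x : F).
Local Notation OK := (ring_of_integers (Qadjoin x)).

Lemma Qadjoin_id : Qadjoin x x.
Proof. by move=> S _. Qed.

Lemma Qadjoin1 : Qadjoin x 1.
Proof. by move=> S [S1 _ _] _. Qed.

Lemma QadjoinB y z : Qadjoin x y -> Qadjoin x z -> Qadjoin x (y - z).
Proof. by move=> yK zK S SP xS; case: (SP) => _ SB _; apply: SB;
  [apply: yK | apply: zK]. Qed.

Lemma Qadjoin_div y z : Qadjoin x y -> Qadjoin x z -> Qadjoin x (y / z).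
Proof. by move=> yK zK S SP xS; case: (SP) => _ _ Sd; apply: Sd;
  [apply: yK | apply: zK]. Qed.

Lemma Qadjoin0 : Qadjoin x 0.
Proof. by rewrite -(subrr 1); apply: QadjoinB; apply: Qadjoin1. Qed.

Lemma QadjoinD y z : Qadjoin x y -> Qadjoin x z -> Qadjoin x (y + z).
Proof.
move=> yK zK; rewrite -[z]opprK -[- z]add0r; apply: QadjoinB => //.
by apply: QadjoinB => //; apply: Qadjoin0.
Qed.

Lemma QadjoinM y z : Qadjoin x y -> Qadjoin x z -> Qadjoin x (y * z).
Proof.
(* A product is division by an inverse; $0^{-1} = 0$ covers $z = 0$. *)
move=> yK zK; rewrite -[z]invrK -[z^-1]mul1r; apply: Qadjoin_div => //.
by apply: Qadjoin_div => //; apply: Qadjoin1.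
Qed.

Lemma QadjoinX n y : Qadjoin x y -> Qadjoin x (y ^+ n).
Proof.
by move=> yK; elim: n => [|n IH]; [apply: Qadjoin1 | rewrite exprS; apply: QadjoinM].
Qed.

Lemma Qadjoin_nat n : Qadjoin x n%:R.
Proof.
elim: n => [|n IH]; first exact: Qadjoin0.
by rewrite mulrS; apply: QadjoinD; first exact: Qadjoin1.
Qed.

Lemma Qadjoin_crit_orbit d i : Qadjoin x (crit_orbit d x i).
Proof.
elim: i => [|i IH]; first exact: Qadjoin0.
by rewrite crit_orbitS; apply: QadjoinD Qadjoin_id; apply: QadjoinX.
Qed.

Lemma ring_of_integersP y : OK y <-> Qadjoin x y /\ y \in algint.
Proof. by split=> -[yK /algintP yA]. Qed.

Lemma ring_of_integers1 : OK 1.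
Proof. by apply/ring_of_integersP; split; [apply: Qadjoin1 | apply: rpred1]. Qed.

Lemma ring_of_integers0 : OK 0.
Proof. by apply/ring_of_integersP; split; [apply: Qadjoin0 | apply: rpred0]. Qed.

Lemma ring_of_integersD y z : OK y -> OK z -> OK (y + z).
Proof.
move=> /ring_of_integersP[yK yA] /ring_of_integersP[zK zA].
by apply/ring_of_integersP; split; [apply: QadjoinD | apply: rpredD].
Qed.

Lemma ring_of_integersM y z : OK y -> OK z -> OK (y * z).
Proof.
move=> /ring_of_integersP[yK yA] /ring_of_integersP[zK zA].
by apply/ring_of_integersP; split; [apply: QadjoinM | apply: rpredM].
Qed.

Lemma principal_ideal1 : principal_ideal OK 1 = OK.
Proof.
rewrite predeqE => y; split=> [[z zO <-]|yO]; first by rewrite mul1r.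
by exists y => //; rewrite mul1r.
Qed.

Lemma ideal_mul_principal y z :
  ideal_mul (principal_ideal OK y) (principal_ideal OK z) =
  principal_ideal OK (y * z).
Proof.
rewrite predeqE => w; split=> [[k [u [v [uP vP ->]]]]|[t tO <-]]; last first.
  exists 1%N, (fun=> y), (fun=> z * t); split=> [_|_|].
  - by exists 1; rewrite ?mulr1 //; apply: ring_of_integers1.
  - by exists t.
  - by rewrite big_ord1 mulrA.
apply: (big_ind (principal_ideal OK (y * z))).
- by exists 0; rewrite ?mulr0 //; apply: ring_of_integers0.
- move=> _ _ [s sO <-] [t tO <-]; exists (s + t); last by rewrite mulrDr.
  exact: ring_of_integersD.
move=> j _; have [s sO <-] := uP j; have [t tO <-] := vP j.
by exists (s * t); [apply: ring_of_integersM | rewrite mulrACA].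
Qed.

Lemma ideal_exp_principal y k :
  ideal_exp OK (principal_ideal OK y) k = principal_ideal OK (y ^+ k).
Proof.
elim: k => [|k IH]; first by rewrite principal_ideal1.
by rewrite /ideal_exp iterS -/(ideal_exp _ _ _) IH ideal_mul_principal exprS.
Qed.

(** Descent to $\mathcal{O}_K$: the integral quotient is $z/y$, which already lies in $K$. *)
Lemma principal_ideal_sub y z : Qadjoin x y -> Qadjoin x z -> y != 0 ->
  advd y z -> (principal_ideal OK z `<=` principal_ideal OK y)%classic.
Proof.
move=> yK zK y0 [u uA zE] _ [t tO <-]; exists (u * t); last by rewrite zE mulrA.
apply: ring_of_integersM => //; apply/ring_of_integersP; split=> //.
by rewrite -[u](mulKf y0) -zE mulrC; apply: Qadjoin_div.
Qed.

Lemma principal_ideal_eq y z : Qadjoin x y -> Qadjoin x z -> y != 0 ->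
  aassoc y z -> principal_ideal OK y = principal_ideal OK z.
Proof.
move=> yK zK y0 [yz zy]; apply/seteqP; split; apply: principal_ideal_sub => //.
by apply: contraNneq y0 => z0; case: zy => u _ ->; rewrite z0 mul0r.
Qed.

End NumberFieldIdeals.

Theorem theorem1p4 (R : realType) (p e m n : nat) (c0 : R[i])
    (p_prime : prime p) (e_ge1 : (1 <= e)%N) (m_gt0 : (0 < m)%N)
    (pcf : pcf_exact_type (p ^ e) c0 m n) :
  let d := (p ^ e)%N in
  let a := crit_orbit d c0 in
  let zeta := a (m + n - 1)%N / a (m - 1)%N in
  let OK := ring_of_integers (Qadjoin c0) in
  [/\ zeta ^+ d = 1,
      zeta <> 1
    & exists r : nat,
      [/\ (r <= e - 1)%N,
          zeta ^+ (p ^ r.+1) = 1,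
          forall s : nat, zeta ^+ (p ^ s.+1) = 1 -> (r <= s)%N
        & forall i : nat, (1 <= i)%N ->
          (~~ (n %| m - 1)%N ->
             ideal_exp OK (principal_ideal OK (a i))
               (p ^ r * (p - 1) * d ^ (m - 1))
             = if (n %| i)%N then principal_ideal OK p%:R else OK)
          /\
          ((n %| m - 1)%N ->
             ideal_exp OK (principal_ideal OK (a i))
               (p ^ r * (p - 1) * (d ^ (m - 1) - 1))
             = if (n %| i)%N then principal_ideal OK p%:R else OK)]].
Proof.
move=> d a zeta OK; split.
- exact: (pcf_zeta_unity p_prime e_ge1 m_gt0 pcf).
- exact: (pcf_zeta_neq1 m_gt0 pcf).
have [r [re rE rmin rprim]] := pcf_zeta_order p_prime e_ge1 m_gt0 pcf.
exists r; split=> // i i_gt0.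
have := crit_orbit_pow_assoc p_prime e_ge1 m_gt0 pcf rprim i_gt0.
have idE k : aassoc (a i ^+ k) (if (n %| i)%N then p%:R else 1) ->
    ideal_exp OK (principal_ideal OK (a i)) k =
    if (n %| i)%N then principal_ideal OK p%:R else OK.
  move=> ak; rewrite ideal_exp_principal (principal_ideal_eq _ _ _ ak).
  - by case: ifP => // _; rewrite principal_ideal1.
  - exact/QadjoinX/Qadjoin_crit_orbit.
  - by case: ifP => _; [apply: Qadjoin_nat | apply: Qadjoin1].
  - by rewrite expf_neq0 // (pcf_orbit_neq0 m_gt0 pcf).
(* Deciding $n \mid m-1$ turns [eps] into 1 or 0 and makes the premise of the other clause false. *)
case: (boolP (n %| m - 1)%N) => nm /=; last rewrite subn0; by move/idE.
Qed.
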